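(* Let $\pi\in\mathfrak X^2(M)$ be a foliated bivector field on $M$, with associated almost Lie algebroid $\pi^\#\colon T^*M\to TM$ over $\mathcal F_\pi=\pi^\#(\Omega^1(M))$, where $\pi^\#$ has constant rank $r$ on $M_{\mathrm{reg}}$. Then $\mathrm{Nbl}^{\ker}_{\mathcal F_\pi}(M)$ and $\mathrm{Nbl}^{\mathrm{Im}}_{\mathcal F_\pi}(M)$ are canonically isomorphic (as spaces over $M$): $\mathrm{Nbl}^{\ker}_{\mathcal F_\pi}(M)\simeq\mathrm{Nbl}^{\mathrm{Im}}_{\mathcal F_\pi}(M)$.
   Context: $M$ is a smooth, real analytic or complex manifold (or algebraic variety over $\mathbb K\in\{\mathbb R,\mathbb C\}$). For a bivector field $\pi$, $\pi^\#\colon T^*M\to TM$ is the vector bundle morphism with $\langle\pi^\#(\alpha),\beta\rangle=\langle\pi,\alpha\wedge\beta\rangle$ for $\alpha,\beta\in\Omega^1(M)$. $\pi$ is called foliated if $[\pi^\#(\Omega^1(M)),\pi^\#(\Omega^1(M))]\subset\pi^\#(\Omega^1(M))$, so that $\mathcal F_\pi=\pi^\#(\Omega^1(M))$ is a singular foliation (Poisson structures are examples); then $T^*M$ with anchor $\pi^\#$ can be equipped with a skew-symmetric bracket making it an almost Lie algebroid (Leibniz rule, and anchor preserving brackets, but not necessarily Jacobi) over $\mathcal F_\pi$. $M_{\mathrm{reg}}\subseteq M$ is the open dense subset where the rank of $\pi^\#$ is locally constant; this rank is assumed to be a constant $r$ on $M_{\mathrm{reg}}$. $\mathrm{Grass}_r(TM)\to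 M$ is the bundle of $r$-dimensional subspaces of the fibers of $TM$ and $\mathrm{Grass}_{-r}(T^*M)\to M$ is the bundle of subspaces of codimension $r$ of the fibers of $T^*M$. $\mathrm{Nbl}^{\mathrm{Im}}_{\mathcal F_\pi}(M)$ is the closure of $\{\mathrm{Im}\,\pi^\#_x : x\in M_{\mathrm{reg}}\}$ in $\mathrm{Grass}_r(TM)$, and $\mathrm{Nbl}^{\ker}_{\mathcal F_\pi}(M)$ is the closure of $\{\ker\pi^\#_x : x\in M_{\mathrm{reg}}\}$ in $\mathrm{Grass}_{-r}(T^*M)$. *)

(* Defs.v *)
From HB Require Import structures.
From mathcomp Require Import all_boot all_order all_algebra.
From mathcomp Require mpoly.
From mathcomp Require Import complex.
From mathcomp Require Import all_classical all_reals all_analysis.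

Set Implicit Arguments.
Unset Strict Implicit.
Unset Printing Implicit Defensive.

Import Order.TTheory GRing.Theory Num.Theory.
Import numFieldNormedType.Exports.

Local Open Scope classical_set_scope.
Local Open Scope ring_scope.

(** * Geometries

   Smooth, real analytic and complex manifolds and nonsingular real or complex
   algebraic varieties are treated uniformly.  A geometry fixes the field of
   scalars, a topology on the affine spaces 'M_(p, q) and a sheaf of regular
   functions on them.  Real varieties are sets of real points, as usual in real
   algebraic geometry. *)

Inductive geometry :=
  Smooth | RealAnalytic | Holomorphic | RealAlgebraic | ComplexAlgebraic.

Definition algebraic (g : geometry) : bool :=
  match g with RealAlgebraic | ComplexAlgebraic => true | _ => false end.

Definition scalars (R : realType) (g : geometry) : numFieldType :=
  match g with
  | Smooth | RealAnalytic | RealAlgebraic => (R : numFieldType)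
  | Holomorphic | ComplexAlgebraic => (R[i] : numFieldType)
  end.

Definition poly_eval (K : numFieldType) (p q : nat)
    (f : mpoly.mpoly (p * q) K) (z : 'M[K]_(p, q)) : K :=
  mpoly.meval (fun k => mxvec z 0 k) f.

(* The Zariski topology, generated by the principal open sets. *)
Definition zariski (K : numFieldType) (p q : nat) : Type := 'M[K]_(p, q).

HB.instance Definition _ (K : numFieldType) (p q : nat) :=
  Choice.on (zariski K p q).

Definition principal_open (K : numFieldType) (p q : nat) :
    set (set (zariski K p q)) :=
  [set U | exists f : mpoly.mpoly (p * q) K,
     U = [set z : 'M[K]_(p, q) | poly_eval f z != 0]].

HB.instance Definition _ (K : numFieldType) (p q : nat) :=
  isSubBaseTopological.Build (zariski K p q)
    (@principal_open K p q) (fun U : set (zariski K p q) => U).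

Section Functions.
Context (K : numFieldType) (p q : nat).
Implicit Types (O : set 'M[K]_(p, q)) (f : 'M[K]_(p, q) -> K).

Fixpoint Ck (k : nat) O f : Prop :=
  match k with
  | 0 => forall z, O z -> {for z, continuous f}
  | k'.+1 => (forall z, O z -> differentiable (f : 'M[K]_(p, q) -> K^o) z) /\
             (forall v, Ck k' O ('D_v (f : 'M[K]_(p, q) -> K^o)))
  end.

Definition smooth_on O f : Prop := forall k, Ck k O f.

(* A multi-index is a matrix [a] of natural numbers, with coefficient [c a].
   The bound on the coefficients makes the power series converge absolutely on
   the open polydisc of radius [rho], so that its sum is the limit of the
   partial sums over the boxes of multi-indices with entries below [k]. *)
Definition analytic_on O f : Prop :=
  smooth_on O f /\
  forall z, O z -> exists (c : 'M[nat]_(p, q) -> K) (rho C : K),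
    [/\ 0 < rho,
        forall a, `|c a| * rho ^+ (\sum_i \sum_j a i j)%N <= C &
        forall h : 'M[K]_(p, q), (forall i j, `|h i j| < rho) ->
          (fun k => \sum_(a : 'M['I_k]_(p, q))
             c (map_mx (@nat_of_ord k) a) * \prod_i \prod_j h i j ^+ a i j)
            @ \oo --> f (z + h)].

Definition holomorphic_on O f : Prop :=
  forall z, O z -> differentiable (f : 'M[K]_(p, q) -> K^o) z.

Definition rational_on O f : Prop :=
  forall z, O z -> exists U : set (zariski K p q),
    [/\ open U, U z & exists a b : mpoly.mpoly (p * q) K,
        forall y, U y -> poly_eval b y != 0 /\
                         f y = poly_eval a y / poly_eval b y].

End Functions.

Section Geometry.
Context (R : realType) (g : geometry).
Let K := scalars R g.

Definition gopen (p q : nat) (O : set 'M[K]_(p, q)) : Prop :=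
  if algebraic g then open (O : set (zariski K p q)) else open O.

(* Only meant for open [O]. *)
Definition regular (p q : nat) (O : set 'M[K]_(p, q))
    (f : 'M[K]_(p, q) -> K) : Prop :=
  match g with
  | Smooth => smooth_on O f
  | RealAnalytic => analytic_on O f
  | Holomorphic => holomorphic_on O f
  | RealAlgebraic | ComplexAlgebraic => rational_on O f
  end.

Lemma gopenT (p q : nat) : gopen (setT : set 'M[K]_(p, q)).
Proof. by rewrite /gopen; case: ifP => _; exact: openT. Qed.

Lemma gopenI (p q : nat) (A B : set 'M[K]_(p, q)) :
  gopen A -> gopen B -> gopen (A `&` B).
Proof. by rewrite /gopen; case: ifP => _; exact: openI. Qed.

Lemma gopen_bigcup (p q : nat) (J : Type) (D : set J)
    (F : J -> set 'M[K]_(p, q)) :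
  (forall j, D j -> gopen (F j)) -> gopen (\bigcup_(j in D) F j).
Proof. by rewrite /gopen; case: ifP => _ FD; exact: bigcup_open. Qed.

Definition regular_mx (p q k l : nat) (O : set 'M[K]_(p, q))
    (F : 'M[K]_(p, q) -> 'M[K]_(k, l)) : Prop :=
  forall i j, regular O (fun z => F z i j).

(** * Local models: nonsingular locally closed subsets of K^N *)

(* [Ft] extends the restriction of [F] to [Z], in a neighbourhood of [z]. *)
Definition local_extension (N k l : nat) (Z : set 'rV[K]_N) (z : 'rV[K]_N)
    (F Ft : 'rV[K]_N -> 'M[K]_(k, l)) : Prop :=
  exists O : set 'rV[K]_N,
    [/\ gopen O, O z, regular_mx O Ft & forall y, O y -> Z y -> Ft y = F y].

Definition regular_on_model (N k l : nat) (Z : set 'rV[K]_N)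
    (F : 'rV[K]_N -> 'M[K]_(k, l)) : Prop :=
  forall z, Z z -> exists Ft, local_extension Z z F Ft.

(* Jacobian criterion: near each of its points, [Z] is the zero set of N - n
   regular functions with independent differentials.  For N = n it says that
   [Z] is open. *)
Definition nonsingular (N n : nat) (Z : set 'rV[K]_N) : Prop :=
  (n <= N)%N /\
  forall z, Z z -> exists (O : set 'rV[K]_N) (f : 'rV[K]_N -> 'rV[K]_(N - n)),
    [/\ gopen O, O z, regular_mx O f,
        forall y, O y -> (Z y <-> f y = 0) &
        \rank (jacobian f z) = (N - n)%N].

(* The tangent space T_z Z, as a subspace of K^N. *)
Definition tangent (N : nat) (Z : set 'rV[K]_N) (z : 'rV[K]_N) :
    set 'rV[K]_N :=
  [set v | forall (O : set 'rV[K]_N) (f : 'rV[K]_N -> 'rV[K]_1),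
     gopen O -> O z -> regular_mx O f -> (forall y, O y -> Z y -> f y = 0) ->
     v *m jacobian f z = 0].

(* Covectors are written as rows, [l] being the linear form v |-> v *m l^T.
   The cotangent space of [Z] at [z] is the quotient of the space of all rows
   by the conormal space. *)
Definition conormal (N : nat) (Z : set 'rV[K]_N) (z : 'rV[K]_N) :
    set 'rV[K]_N :=
  [set l | forall v, tangent Z z v -> v *m l^T = 0].

End Geometry.

(** * Manifolds and varieties *)

Section LocalTransition.
Context (R : realType) (g : geometry).
Let K := scalars R g.
Context (X I : Type) (N : nat) (dom : I -> set X) (chart : I -> X -> 'rV[K]_N).

(* Near [chart i x], the change of charts from [i] to [j] is defined and is the
   restriction of [F]. *)
Definition local_transition (i j : I) (x : X)
    (F : 'rV[K]_N -> 'rV[K]_N) : Prop :=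
  dom i x /\ exists O : set 'rV[K]_N,
    [/\ gopen O, O (chart i x), regular_mx O F &
        forall y, dom i y -> O (chart i y) ->
          dom j y /\ chart j y = F (chart i y)].

End LocalTransition.

(* In the three manifold geometries charts take values in open subsets of K^n.
   In the algebraic ones they are nonsingular of dimension n in some K^N; as
   the atlas may be taken finite, one N serves for all charts. *)
Record manifold (R : realType) (g : geometry) (n : nat) := Manifold {
  carrier :> Type;
  chart_index : Type;
  amb : nat;
  dom : chart_index -> set carrier;
  chart : chart_index -> carrier -> 'rV[scalars R g]_amb;
  model := fun i => chart i @` dom i;
  _ : forall i, set_inj (dom i) (chart i);
  _ : forall i, nonsingular n (model i);
  _ : forall i j x, dom i x -> dom j x ->
        exists F, local_transition dom chart i j x F;
  (* Hausdorff, resp. separated: the diagonal is closed *)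
  _ : forall i j, exists2 O : set 'rV[scalars R g]_(amb + amb), gopen O &
        forall u v, model i u -> model j v ->
          (O (row_mx u v) <->
           ~ exists x, [/\ dom i x, dom j x, chart i x = u & chart j x = v]);
  _ : if algebraic g
      then exists2 J : set chart_index, finite_set J &
             forall x, exists2 i, J i & dom i x
      else amb = n /\
           exists2 J : set chart_index, countable J &
             forall x, exists2 i, J i & dom i x
}.

(* A topology on [X] from partial parametrizations [par i], relations between
   points of [X] and coordinates in 'M_(p, q): [S] is open when its inverse
   image by each [par i] is relatively open. *)
Section FinalTopology.
Context (R : realType) (g : geometry) (X I : Type) (p q : nat).
Context (par : I -> X -> 'M[scalars R g]_(p, q) -> Prop).

Definition final_open : set (set X) :=
  [set S | forall i, exists2 O : set 'M[scalars R g]_(p, q), gopen O &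
     forall x B, par i x B -> (O B <-> S x)].

Lemma final_openT : final_open setT.
Proof. by move=> i; exists setT => //; exact: gopenT. Qed.

Lemma final_openI (A B : set X) :
  final_open A -> final_open B -> final_open (A `&` B).
Proof.
move=> oA oB i; have [U gU hA] := oA i; have [V gV hB] := oB i.
exists (U `&` V); first exact: gopenI.
by move=> x C xC; split=> -[/(hA _ _ xC) ? /(hB _ _ xC) ?].
Qed.

Lemma final_open_bigU (J : Type) (F : J -> set X) :
  (forall j, final_open (F j)) -> final_open (\bigcup_j F j).
Proof.
move=> oF i; pose good j O := gopen O /\ forall x C, par i x C -> (O C <-> F j x).
exists (\bigcup_(O in [set O | exists j, good j O]) O).
  by apply: gopen_bigcup => O [j [oO _]].
move=> x C xC; split=> [[U [j [_ h]] UC]|[j _ Fjx]].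
  by exists j => //; apply/(h _ _ xC).
have [U oU h] := oF j i; exists U; first by exists j.
by apply/(h _ _ xC).
Qed.

End FinalTopology.

Section ManifoldTopology.
Context (R : realType) (g : geometry) (n : nat) (M : manifold R g n).

Definition chart_graph (i : chart_index M) (x : M)
    (z : 'rV[scalars R g]_(amb M)) : Prop :=
  dom i x /\ z = chart i x.

HB.instance Definition _ := gen_eqMixin (carrier M).
HB.instance Definition _ := gen_choiceMixin (carrier M).
HB.instance Definition _ := isOpenTopological.Build (carrier M)
  (final_openT chart_graph) (@final_openI _ _ _ _ _ _ chart_graph)
  (@final_open_bigU _ _ _ _ _ _ chart_graph).

End ManifoldTopology.

(** * Grassmann bundles of the tangent and cotangent bundles *)

Section Grassmann.
Context (R : realType) (g : geometry) (n : nat) (M : manifold R g n).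
Let K := scalars R g.
Let N := amb M.

Definition transition (i j : chart_index M) (x : M) (F : 'rV[K]_N -> 'rV[K]_N) :=
  local_transition (@dom R g n M) (@chart R g n M) i j x F.

Definition tangent_at (i : chart_index M) (x : M) : set 'rV[K]_N :=
  tangent (model i) (chart i x).

Definition conormal_at (i : chart_index M) (x : M) : set 'rV[K]_N :=
  conormal (model i) (chart i x).

(* A subspace of T_x M is given by its images [V i] in the charts at [x].  The
   differentials of the changes of charts are mutually inverse on tangent
   spaces, so that, with equal dimensions, inclusion for all (i, j) amounts to
   equality; the same holds for covectors below. *)
Definition sub_TM (x : M) (V : chart_index M -> {vspace 'rV[K]_N}) : Prop :=
  (forall i, dom i x -> forall v, v \in V i -> tangent_at i x v) /\
  (forall i j F, transition i j x F ->
     forall v, v \in V i -> v *m jacobian F (chart i x) \in V j).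

(* A subspace of T*_x M is given in the chart [i] by its inverse image [W i] in
   the space of rows, which contains the conormal space and has the same
   codimension.  Covectors are pulled back along changes of charts. *)
Definition sub_cotM (x : M) (W : chart_index M -> {vspace 'rV[K]_N}) : Prop :=
  (forall i, dom i x -> forall l, conormal_at i x l -> l \in W i) /\
  (forall i j F, transition i j x F ->
     forall l, l \in W j -> l *m (jacobian F (chart i x))^T \in W i).

(* Chart-wise subspaces of dimension [d] subject to [P]; the convention outside
   the domains of the charts makes the representation unique. *)
Record planes (d : nat)
    (P : M -> (chart_index M -> {vspace 'rV[K]_N}) -> Prop) := Planes {
  foot : M;
  plane : chart_index M -> {vspace 'rV[K]_N};
  _ : forall i, dom i foot -> \dim (plane i) = d;
  _ : forall i, ~ dom i foot -> plane i = 0%VS;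
  _ : P foot plane
}.

(* [B] lists the coordinates of the base point of [p] and, below, a basis of
   [plane p i].  The resulting topology is the usual one on a Grassmann bundle,
   as a quotient of the bundle of frames. *)
Definition frame d P (i : chart_index M) (p : planes d P) (B : 'M[K]_(1 + d, N)) :=
  [/\ dom i (foot p), usubmx B = chart i (foot p) &
      limg (linfun (mulmxr (dsubmx B) : 'rV[K]_d -> 'rV[K]_N)) = plane p i].

HB.instance Definition _ d P := gen_eqMixin (planes d P).
HB.instance Definition _ d P := gen_choiceMixin (planes d P).
HB.instance Definition _ d P := isOpenTopological.Build (planes d P)
  (final_openT (@frame d P)) (@final_openI _ _ _ _ _ _ (@frame d P))
  (@final_open_bigU _ _ _ _ _ _ (@frame d P)).

Definition Grass (r : nat) := planes r sub_TM.

(* As r <= N is required, the subtraction is not truncated. *)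
Definition Grass_codim (r : nat) :=
  planes (N - r) (fun x W => (r <= N)%N /\ sub_cotM x W).

(* A map over M is regular on [A] when, in charts, it is given on frames by
   regular functions. *)
Definition regular_over d P d' P' (A : set (planes d P))
    (f : planes d P -> planes d' P') : Prop :=
  forall i p B, A p -> frame i p B ->
    exists (O : set 'M[K]_(1 + d, N)) (G : 'M[K]_(1 + d, N) -> 'M[K]_(d', N)),
      [/\ gopen O, O B, regular_mx O G &
          forall q C, A q -> frame i q C -> O C ->
            frame i (f q) (col_mx (usubmx C) (G C))].

(* [f] and [h] are mutually inverse isomorphisms over M between [A] and [B]. *)
Record isomorphism_over d P d' P' (A : set (planes d P))
    (B : set (planes d' P')) (f : planes d P -> planes d' P')
    (h : planes d' P' -> planes d P) : Prop := IsomorphismOver {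
  iso_fun : set_fun A B f;
  iso_inv : set_fun B A h;
  iso_cancel : forall p, A p -> h (f p) = p;
  iso_inv_cancel : forall q, B q -> f (h q) = q;
  iso_base : forall p, A p -> foot (f p) = foot p;
  iso_continuous : {within A, continuous f};
  iso_inv_continuous : {within B, continuous h};
  iso_regular : regular_over A f;
  iso_inv_regular : regular_over B h
}.

End Grassmann.

(** * Bivector fields *)

Section Bivectors.
Context (R : realType) (g : geometry) (n : nat) (M : manifold R g n).
Let K := scalars R g.
Let N := amb M.

(* In each chart, a regular section of the second exterior power of the tangent
   bundle: <pi, a /\ b> = a *m bivector_mx pi i z *m b^T, so that
   pi^#(a) = a *m bivector_mx pi i z. *)
Record bivector := Bivector {
  bivector_mx : chart_index M -> 'rV[K]_N -> 'M[K]_N;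
  _ : forall i, regular_on_model (model i) (bivector_mx i);
  _ : forall i z, model i z -> (bivector_mx i z)^T = - bivector_mx i z;
  _ : forall i z, model i z -> forall a, tangent (model i) z (a *m bivector_mx i z);
  _ : forall i j x F, transition i j x F ->
        bivector_mx j (chart j x) =
          (jacobian F (chart i x))^T *m bivector_mx i (chart i x)
            *m jacobian F (chart i x)
}.

(* Coefficients are only meaningful modulo conormal covectors. *)
Record one_form := OneForm {
  form_coef : chart_index M -> 'rV[K]_N -> 'rV[K]_N;
  _ : forall i z, model i z -> exists (O : set 'rV[K]_N) (A : 'rV[K]_N -> 'rV[K]_N),
        [/\ gopen O, O z, regular_mx O A &
            forall y, O y -> model i y ->
              conormal (model i) y (A y - form_coef i y)];
  _ : forall i j x F, transition i j x F ->
        conormal_at i x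
          (form_coef j (chart j x) *m (jacobian F (chart i x))^T
             - form_coef i (chart i x))
}.

Definition sharp (pi : bivector) (a : one_form) (i : chart_index M) (z : 'rV[K]_N) :
    'rV[K]_N :=
  form_coef a i z *m bivector_mx pi i z.

(* [Z] is the Lie bracket of the vector fields [X] and [Y], given in charts by
   [X, Y] = dY(X) - dX(Y) for any local extensions. *)
Definition is_bracket (X Y Z : chart_index M -> 'rV[K]_N -> 'rV[K]_N) : Prop :=
  forall i z, model i z -> forall Xt Yt,
    local_extension (model i) z (X i) Xt ->
    local_extension (model i) z (Y i) Yt ->
    Z i z = X i z *m jacobian Yt z - Y i z *m jacobian Xt z.

Definition foliated (pi : bivector) : Prop :=
  forall a b : one_form, exists c : one_form,
    is_bracket (sharp pi a) (sharp pi b) (sharp pi c).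

Definition rank_at (pi : bivector) (x : M) (k : nat) : Prop :=
  forall i, dom i x -> \rank (bivector_mx pi i (chart i x)) = k.

Definition Mreg (pi : bivector) : set M :=
  [set x | exists k, \forall y \near x, rank_at pi y k].

Definition sharp_lin (pi : bivector) (i : chart_index M) (x : M) :
    'Hom('rV[K]_N, 'rV[K]_N) :=
  linfun (mulmxr (bivector_mx pi i (chart i x))).

Definition im_points (pi : bivector) (r : nat) : set (Grass M r) :=
  [set p | Mreg pi (foot p) /\
     forall i, dom i (foot p) -> plane p i = limg (sharp_lin pi i (foot p))].

Definition ker_points (pi : bivector) (r : nat) : set (Grass_codim M r) :=
  [set p | Mreg pi (foot p) /\
     forall i, dom i (foot p) -> plane p i = lker (sharp_lin pi i (foot p))].

Definition Nbl_im (pi : bivector) (r : nat) : set (Grass M r) :=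
  closure (im_points pi (r:=r)).

Definition Nbl_ker (pi : bivector) (r : nat) : set (Grass_codim M r) :=
  closure (ker_points pi (r:=r)).

(* [p] is the annihilator of [q]. *)
Definition annihilates (r : nat) (q : Grass_codim M r) (p : Grass M r) : Prop :=
  foot p = foot q /\
  forall i, dom i (foot q) -> forall v : 'rV[K]_N,
    v \in plane p i <-> (forall l, l \in plane q i -> v *m l^T = 0).

End Bivectors.

Arguments im_points {R g n M} pi r _.
Arguments ker_points {R g n M} pi r _.
Arguments Nbl_im {R g n M} pi r _.
Arguments Nbl_ker {R g n M} pi r _.

(* Main.v *)
(** The isomorphism takes a subspace of T*M to its annihilator in TM, and back.
    Skew-symmetry of pi gives Im pi^#_x = (ker pi^#_x)^0, so that the
    annihilator exchanges the two sets of points over M_reg. It is an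
    isomorphism of the whole Grassmann bundles: near a frame C of W choose D
    such that the square matrix [C; D] is invertible; the last columns of its
    adjugate are polynomial in C and form a frame of the annihilator of W as
    long as [C; D] remains invertible. Being a homeomorphism, it then exchanges
    the closures. *)

Require Import Defs.
From mathcomp Require Import all_boot all_order all_algebra.
From mathcomp Require mpoly.
Import (canonicals) mpoly.
From mathcomp Require Import all_classical all_reals all_analysis.

Set Implicit Arguments.
Unset Strict Implicit.
Unset Printing Implicit Defensive.

Import Order.TTheory GRing.Theory Num.Theory.
Import numFieldNormedType.Exports.

Local Open Scope classical_set_scope.
Local Open Scope ring_scope.

(** * Annihilators *)

Section Annihilator.
Context (K : fieldType).

(** Rows are multiplied on the right, so the image is the row space of [A] and the kernel its left
    kernel. The maps in [frame] and [sharp_lin] are of this form up to conversion. *)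
Definition mxfun m n (A : 'M[K]_(m, n)) : 'Hom('rV[K]_m, 'rV[K]_n) :=
  linfun (mulmxr A).

Lemma memv_limg_mx m n (A : 'M[K]_(m, n)) v :
  reflect (exists u, v = u *m A) (v \in limg (mxfun A)).
Proof.
apply: (iffP memv_imgP) => [[u _ ->]|[u ->]]; exists u; rewrite ?lfunE //.
exact: memvf.
Qed.

Lemma memv_lker_mx m n (A : 'M[K]_(m, n)) v :
  (v \in lker (mxfun A)) = (v *m A == 0).
Proof. by rewrite memv_ker lfunE. Qed.

Lemma dim_limg_mx m n (A : 'M[K]_(m, n)) : \dim (limg (mxfun A)) = \rank A.
Proof.
have freeE k (B : 'M[K]_(k, n)) : row_free B -> \dim (limg (mxfun B)) = k.
  move=> freeB; rewrite limg_dim_eq ?dimvf /dim /= ?mul1n //.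
  apply/eqP; rewrite -subv0; apply/subvP => u; rewrite memv_cap memv_lker_mx.
  by case/andP=> _; rewrite (mulmx_free_eq0 _ freeB) memv0.
(* A row base of [A] spans the same row space and is injective on rows, which reduces the claim to
   the free case. *)
rewrite -(freeE _ _ (row_base_free A)); congr (\dim _); apply/eqP.
rewrite eqEsubv; apply/andP; split; apply/subvP => v /memv_limg_mx[u ->];
  apply/memv_limg_mx; apply/submxP.
  by rewrite eq_row_base submxMl.
by apply: submx_trans (submxMl _ _) _; rewrite eq_row_base.
Qed.

Lemma dim_lker_mx m n (A : 'M[K]_(m, n)) :
  \dim (lker (mxfun A)) = (m - \rank A)%N.
Proof.
have := limg_ker_dim (mxfun A) fullv.
rewrite capfv dim_limg_mx dimvf /dim /= mul1n => dimE.
by apply/eqP; rewrite -(eqn_add2r (\rank A)) dimE subnK // rank_leq_row.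
Qed.

Definition basis_mx n (W : {vspace 'rV[K]_n}) : 'M[K]_(\dim W, n) :=
  \matrix_(k < \dim W) (vbasis W)`_k.

Lemma limg_basis_mx n (W : {vspace 'rV[K]_n}) : limg (mxfun (basis_mx W)) = W.
Proof.
apply/vspaceP => v; apply/memv_limg_mx/idP => [[u ->]|vW].
  rewrite mulmx_sum_row; apply: memv_suml => k _; apply: memvZ.
  by rewrite rowK; apply/vbasis_mem/mem_nth; rewrite size_tuple.
exists (\row_k coord (vbasis W) k v).
rewrite mulmx_sum_row {1}(coord_vbasis vW).
by apply: eq_bigr => k _; rewrite mxE rowK.
Qed.

(** Vectors and covectors are both rows and their pairing is symmetric, so this one operation serves
    in both directions. *)
Definition annv n (W : {vspace 'rV[K]_n}) : {vspace 'rV[K]_n} :=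
  lker (mxfun (basis_mx W)^T).

Lemma mulmx_tr_eq0C n (u v : 'rV[K]_n) : (u *m v^T == 0) = (v *m u^T == 0).
Proof. by rewrite -(inj_eq trmx_inj) trmx_mul trmxK trmx0. Qed.

Lemma memv_annv n (W : {vspace 'rV[K]_n}) v :
  v \in annv W <-> forall l, l \in W -> v *m l^T = 0.
Proof.
rewrite memv_lker_mx; split=> [/eqP vW l|vW].
  rewrite -{1}(limg_basis_mx W) => /memv_limg_mx[u ->].
  by rewrite trmx_mul mulmxA vW mul0mx.
apply/eqP/trmx_inj/row_matrixP => k.
rewrite trmx_mul trmxK trmx0 row0 row_mul rowK.
apply/eqP; rewrite mulmx_tr_eq0C; apply/eqP/vW/vbasis_mem/mem_nth.
by rewrite size_tuple.
Qed.

Lemma dim_annv n (W : {vspace 'rV[K]_n}) : \dim (annv W) = (n - \dim W)%N.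
Proof.
by rewrite dim_lker_mx mxrank_tr -[\rank _]dim_limg_mx limg_basis_mx.
Qed.

Lemma dimv_le_rV n (W : {vspace 'rV[K]_n}) : (\dim W <= n)%N.
Proof.
by apply: leq_trans (dimvS (subvf W)) _; rewrite dimvf /dim /= mul1n.
Qed.

(** By symmetry of the pairing, W lies in its double annihilator, and the dimensions agree. *)
Lemma annvK n : involutive (@annv n).
Proof.
move=> W; apply/esym/eqP;
rewrite eqEdim !dim_annv subKn ?dimv_le_rV // leqnn andbT.
apply/subvP => v vW; apply/memv_annv => l /memv_annv/(_ v vW)/eqP.
by rewrite mulmx_tr_eq0C => /eqP.
Qed.

(** If l A = 0, then l pairs with u A to l A^T u^T = - l A u^T = 0. This gives one inclusion, and
    both sides have dimension rank A. *)
Lemma annv_lker_skew n (A : 'M[K]_n) :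
  A^T = - A -> annv (lker (mxfun A)) = limg (mxfun A).
Proof.
move=> skewA; apply/esym/eqP; rewrite eqEdim dim_annv dim_lker_mx dim_limg_mx.
rewrite subKn ?rank_leq_row // leqnn andbT.
apply/subvP => _ /memv_limg_mx[u ->]; apply/memv_annv => l.
rewrite memv_lker_mx => /eqP lA; apply/eqP; rewrite mulmx_tr_eq0C.
by rewrite trmx_mul skewA mulNmx mulmxN mulmxA lA mul0mx oppr0.
Qed.

End Annihilator.

(** * Polynomial frames of annihilators *)

Section AnnihilatorFrame.
Context (K : fieldType) (d d' N : nat) (dN : (d + d')%N = N).

Definition completion (D : 'M[K]_(d', N)) (C : 'M[K]_(d, N)) : 'M[K]_N :=
  castmx (dN, erefl N) (col_mx C D).

(* The last d' columns of the adjugate of [C; D]: they are orthogonal to the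
   rows of C, and polynomial in its entries. *)
Definition ann_frame (D : 'M[K]_(d', N)) (C : 'M[K]_(d, N)) : 'M[K]_(d', N) :=
  (rsubmx (castmx (erefl N, esym dN) (\adj (completion D C))))^T.

(** Let X = [C; D] and adj X = [E, G]. The blocks of X adj X = det X give C G = 0, so the columns of
    G annihilate the rows of C. The diagonal blocks C E and D G are invertible scalars, so C and G
    have full rank and the dimensions match. *)
Lemma limg_ann_frame D C : \det (completion D C) != 0 ->
  limg (mxfun (ann_frame D C)) = annv (limg (mxfun C)).
Proof.
rewrite /ann_frame /completion.
(* Eliminating the equation d + d' = N turns the casts into identities. *)
case: _ / dN D C => D C; rewrite !castmx_id => detX.
set X := col_mx C D in detX *.
have := mul_mx_adj X; rewrite -(hsubmxK (\adj X)) row_mxKr.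
set E := lsubmx _; set G := rsubmx _; rewrite mul_col_row scalar_mx_block.
case/eq_block_mx=> CE CG _ DG.
have rankC : \rank C = d.
  apply/eqP/row_freeP; exists ((\det X)^-1 *: E).
  by rewrite -scalemxAr CE scale_scalar_mx mulVf.
have rankG : \rank G^T = d'.
  apply/eqP/row_freeP; exists ((\det X)^-1 *: D^T).
  by rewrite -scalemxAr -trmx_mul DG tr_scalar_mx scale_scalar_mx mulVf.
apply/eqP; rewrite eqEdim dim_annv !dim_limg_mx rankC rankG addKn leqnn andbT.
apply/subvP => _ /memv_limg_mx[u ->]; apply/memv_annv => _ /memv_limg_mx[w ->].
by rewrite trmx_mul mulmxA -(mulmxA u) -trmx_mul CG trmx0 mulmx0 mul0mx.
Qed.

Lemma completion_exists C : row_free C -> exists D, \det (completion D C) != 0.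
Proof.
rewrite /completion; case: _ / dN C => C freeC; exists (dsubmx (row_ebase C)).
rewrite castmx_id -unitfE -unitmxE.
have CE : C = col_ebase C *m usubmx (row_ebase C).
  rewrite -{1}[C]mulmx_ebase (eqP freeC) -mulmxA; congr (_ *m _).
  by rewrite pid_mx_row -{1}[row_ebase C]vsubmxK mul_row_col mul1mx mul0mx
    addr0.
(* [C; D] is the product of the block diagonal matrix of [col_ebase C] and 1 with [row_ebase C],
   both invertible. *)
rewrite {1}CE (_ : col_mx _ _ = block_mx (col_ebase C) 0 0 1%:M *m row_ebase C).
  rewrite unitmx_mul row_ebase_unit andbT unitmxE det_ublock det1 mulr1.
  by rewrite -unitmxE col_ebase_unit.
by rewrite -{3}[row_ebase C]vsubmxK mul_block_col !mul0mx mul1mx addr0 add0r.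
Qed.

End AnnihilatorFrame.

(** * Polynomial maps are regular in every geometry *)

Section PolynomialFunctions.
Context (K : numFieldType) (p q : nat).

(** Polynomial functions are generated inductively, so that differentiability, stability under
    derivation and Taylor expansion are proved by induction on the construction. *)
Inductive polyfun : ('M[K]_(p, q) -> K) -> Prop :=
| polyfun_cst c : polyfun (fun=> c)
| polyfun_coord i j : polyfun (fun z => z i j)
| polyfunD f g : polyfun f -> polyfun g -> polyfun (fun z => f z + g z)
| polyfunM f g : polyfun f -> polyfun g -> polyfun (fun z => f z * g z).

Lemma polyfun_sum (I : Type) (r : seq I) (P : pred I)
    (F : I -> 'M[K]_(p, q) -> K) :
  (forall i, polyfun (F i)) -> polyfun (fun z => \sum_(i <- r | P i) F i z).
Proof.
move=> polyF; elim: r => [|i r IHr].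
  by under eq_fun do rewrite big_nil; exact: polyfun_cst.
under eq_fun do rewrite big_cons; case: (P i) => //; exact: polyfunD.
Qed.

Lemma polyfun_prod (I : Type) (r : seq I) (P : pred I)
    (F : I -> 'M[K]_(p, q) -> K) :
  (forall i, polyfun (F i)) -> polyfun (fun z => \prod_(i <- r | P i) F i z).
Proof.
move=> polyF; elim: r => [|i r IHr].
  by under eq_fun do rewrite big_nil; exact: polyfun_cst.
under eq_fun do rewrite big_cons; case: (P i) => //; exact: polyfunM.
Qed.

Lemma polyfunX f k : polyfun f -> polyfun (fun z => f z ^+ k).
Proof.
move=> polyf; elim: k => [|k IHk].
  by under eq_fun do rewrite expr0; exact: polyfun_cst.
by under eq_fun do rewrite exprS; exact: polyfunM.
Qed.

Lemma polyfun_det m (X : 'M[K]_(p, q) -> 'M[K]_m) :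
  (forall i j, polyfun (fun z => X z i j)) -> polyfun (fun z => \det (X z)).
Proof.
move=> polyX; apply: polyfun_sum => s; apply: polyfunM.
  exact: polyfun_cst.
exact: polyfun_prod.
Qed.

Lemma polyfun_adj m (X : 'M[K]_(p, q) -> 'M[K]_m) :
  (forall i j, polyfun (fun z => X z i j)) ->
  forall i j, polyfun (fun z => (\adj (X z)) i j).
Proof.
move=> polyX i j; under eq_fun do rewrite mxE /cofactor.
apply: polyfunM; first exact: polyfun_cst.
by apply: polyfun_det => k l; under eq_fun do rewrite !mxE.
Qed.

Lemma polyfun_meval m (f : mpoly.mpoly m K) (F : 'I_m -> 'M[K]_(p, q) -> K) :
  (forall i, polyfun (F i)) -> polyfun (fun z => mpoly.meval (F^~ z) f).
Proof.
move=> polyF; under eq_fun do rewrite mpoly.mevalE.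
apply: polyfun_sum => a; apply: polyfunM; first exact: polyfun_cst.
by apply: polyfun_prod => i; exact: polyfunX.
Qed.

Lemma polyfun_poly_eval f :
  polyfun f -> exists P : mpoly.mpoly (p * q) K, f = poly_eval P.
Proof.
elim=> [c|i j|f1 g1 _ [P ->] _ [Q ->]|f1 g1 _ [P ->] _ [Q ->]].
- exists (mpoly.mpolyC _ c); apply/funext => z.
  by rewrite /poly_eval mpoly.mevalC.
- exists (mpoly.mpolyX _ (mpoly.mnm1 (mxvec_index i j))); apply/funext => z.
  by rewrite /poly_eval mpoly.mevalXU mxvecE.
- by exists (P + Q); apply/funext => z; rewrite /poly_eval mpoly.mevalD.
- by exists (P * Q); apply/funext => z; rewrite /poly_eval mpoly.mevalM.
Qed.

Lemma polyfun_differentiable f z :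
  polyfun f -> differentiable (f : 'M[K]_(p, q) -> K^o) z.
Proof.
elim=> [c|i j|f1 g1 _ df _ dg|f1 g1 _ df _ dg].
- exact: differentiable_cst.
- exact: differentiable_coord.
- exact: differentiableD.
- exact: (@differentiableM _ _ f1 g1).
Qed.

(** Stability under directional derivatives is what makes the induction over [Ck] work. *)
Lemma polyfun_derive f v :
  polyfun f -> polyfun ('D_v (f : 'M[K]_(p, q) -> K^o)).
Proof.
have der g z : polyfun g -> derivable (g : 'M[K]_(p, q) -> K^o) z v.
  by move=> /polyfun_differentiable dg; exact: diff_derivable.
elim=> [c|i j|f1 g1 pf df pg dg|f1 g1 pf df pg dg].
- rewrite (_ : 'D_v _ = fun=> 0); first exact: polyfun_cst.
  by apply/funext => z; exact: derive_cst.
- rewrite (_ : 'D_v _ = fun=> v i j); first exact: polyfun_cst.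
  apply/funext => z; apply: cvg_lim => //.
  (* The difference quotient of a coordinate equals [v i j] for every nonzero h. *)
  apply: cvg_near_cst; near=> h.
  rewrite /= !mxE addrK /GRing.scale /= mulKf //.
  near: h; exact: nbhs_dnbhs_neq.
- rewrite (_ : 'D_v _ =
    fun z => 'D_v (f1 : _ -> K^o) z + 'D_v (g1 : _ -> K^o) z).
    exact: polyfunD.
  by apply/funext => z; rewrite -deriveD //; exact: der.
- rewrite (_ : 'D_v _ = fun z => f1 z * 'D_v (g1 : _ -> K^o) z +
                                 g1 z * 'D_v (f1 : _ -> K^o) z).
    by apply: polyfunD; exact: polyfunM.
  by apply/funext => z; rewrite [LHS]deriveM //; exact: der.
Unshelve. all: by end_near.
Qed.

Lemma polyfun_smooth f (O : set 'M[K]_(p, q)) : polyfun f -> smooth_on O f.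
Proof.
move=> + k; elim: k f => [|k IHk] f polyf /=.
  move=> z _; have := @polyfun_differentiable f z polyf.
  exact: (@differentiable_continuous _ _ K^o).
split=> [z _|v]; first exact: polyfun_differentiable.
by apply: IHk; exact: polyfun_derive.
Qed.

(** * Taylor expansions and analyticity of polynomials *)

Definition monomial (a : 'M[nat]_(p, q)) (h : 'M[K]_(p, q)) : K :=
  \prod_i \prod_j h i j ^+ a i j.

Lemma monomial0 h : monomial 0 h = 1.
Proof.
by rewrite /monomial big1 // => i _; rewrite big1 // => j _; rewrite mxE expr0.
Qed.

Lemma monomialD a b h : monomial (a + b) h = monomial a h * monomial b h.
Proof.
rewrite /monomial -big_split; apply: eq_bigr => i _; rewrite -big_split.
by apply: eq_bigr => j _; rewrite mxE exprD.
Qed.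

Lemma monomial_delta i j h : monomial (delta_mx i j) h = h i j.
Proof.
rewrite /monomial (bigD1 i) //= (bigD1 j) //= !mxE !eqxx expr1.
rewrite !big1 ?mulr1 // => [k /negPf ki|k /negPf kj].
  by rewrite big1 // => l _; rewrite mxE ki expr0.
by rewrite mxE kj andbF expr0.
Qed.

(** The expansion is a list of coefficients and exponents in which exponents may repeat: a sum of
    functions concatenates the lists, a product takes all pairs. *)
Lemma polyfun_taylor f (z : 'M[K]_(p, q)) : polyfun f ->
  exists s : seq (K * 'M[nat]_(p, q)),
    forall h, f (z + h) = \sum_(t <- s) t.1 * monomial t.2 h.
Proof.
elim=> [c|i j|f1 g1 _ [s hs] _ [t ht]|f1 g1 _ [s hs] _ [t ht]].
- by exists [:: (c, 0)] => h; rewrite big_seq1 monomial0 mulr1.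
- exists [:: (z i j, 0); (1, delta_mx i j)] => h.
  by rewrite big_cons big_seq1 monomial0 monomial_delta mulr1 mul1r mxE.
- by exists (s ++ t) => h; rewrite big_cat hs ht.
- exists [seq (u.1 * v.1, u.2 + v.2) | u <- s, v <- t] => h.
  rewrite big_allpairs_dep hs ht big_distrlr /=.
  by apply: eq_bigr => u _; apply: eq_bigr => v _; rewrite monomialD mulrACA.
Qed.

Lemma polyfun_analytic f (O : set 'M[K]_(p, q)) : polyfun f -> analytic_on O f.
Proof.
move=> polyf; split=> [|z Oz]; first exact: polyfun_smooth.
have [s hs] := polyfun_taylor z polyf.
(* The coefficient at [a] collects all terms with exponent [a]. With radius 1, the sum of the
   absolute values of the listed coefficients bounds each of them. *)
exists (fun a => \sum_(t <- s | t.2 == a) t.1), 1, (\sum_(t <- s) `|t.1|).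
split=> // [a|h _].
  rewrite expr1n mulr1 big_mkcond; apply: le_trans (ler_norm_sum _ _ _) _.
  by apply: ler_sum => t _; case: ifP; rewrite ?normr0.
rewrite hs; apply: cvg_near_cst.
(* Beyond this index every exponent lies in the box, so the partial sums are constant. The successor
   makes each entry strictly smaller than k. *)
exists (\sum_(t <- s) \sum_i \sum_j (t.2 i j).+1)%N => // k /= ltk.
under eq_bigr do rewrite mulr_suml big_mkcond.
rewrite exchange_big /= big_seq [RHS]big_seq; apply: eq_bigr => t ts.
have lt_k i j : (t.2 i j < k)%N.
  apply: leq_trans ltk.
  rewrite (big_rem t) //= (bigD1 i) //= (bigD1 j) //= -!addnA; exact: leq_addr.
pose b : 'M['I_k]_(p, q) := \matrix_(i, j) Ordinal (lt_k i j).
have bE : map_mx (@nat_of_ord k) b = t.2 by apply/matrixP => i j; rewrite !mxE.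
(* The term [t] contributes at exactly one index of the box, namely its own exponent [b]. *)
rewrite (bigD1 b) //= bE eqxx [X in _ + X]big1 ?addr0 => [|a ab].
  congr (_ * _); apply: eq_bigr => i _; apply: eq_bigr => j _.
  by rewrite mxE.
case: eqP => // tE; case/negP: ab; apply/eqP/matrixP => i j.
by apply: val_inj; rewrite mxE /= tE mxE.
Qed.

Lemma polyfun_rational f (O : set 'M[K]_(p, q)) : polyfun f -> rational_on O f.
Proof.
move=> /polyfun_poly_eval[P ->] z _.
exists setT; split=> //; first exact: openT.
exists P, 1 => y _; split; rewrite /poly_eval mpoly.meval1 ?oner_neq0 //.
by rewrite divr1.
Qed.

End PolynomialFunctions.

(** * Polynomial maps and the topologies of the geometries *)

Section Regular.
Context (R : realType) (g : geometry) (p q : nat).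
Let K := scalars R g.

(** Each notion of regularity is established over the scalars of [g] first; the case analysis on [g]
    then selects the relevant one. *)
Lemma polyfun_regular (f : 'M[K]_(p, q) -> K) (O : set 'M[K]_(p, q)) :
  polyfun f -> regular O f.
Proof.
move=> polyf; rewrite /regular.
have := @polyfun_smooth _ _ _ f O polyf.
have := @polyfun_analytic _ _ _ f O polyf.
have := @polyfun_rational _ _ _ f O polyf.
have : holomorphic_on O f by move=> z _; exact: polyfun_differentiable.
by rewrite {}/K in f O polyf *; case: g f O polyf.
Qed.

Lemma polyfun_continuous_mx (L : numFieldType) k l
    (F : 'M[L]_(p, q) -> 'M[L]_(k, l)) :
  (forall i j, polyfun (fun z => F z i j)) -> continuous F.
Proof.
(* A neighbourhood of a matrix contains a box of neighbourhoods [P i j] of its entries; there are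
   finitely many, so they can be met simultaneously. *)
move=> polyF z S [P FP PS]; rewrite /nbhs /= /fmap /=.
have PF i j : \forall y \near z, P i j (F y i j).
  have := @polyfun_differentiable _ _ _ _ z (polyF i j).
  by move=> /(@differentiable_continuous _ _ L^o); apply; exact: FP.
have : nbhs z (fun y => forall i j, P i j (F y i j)).
  have nz := nbhs_filter z.
  have := filter_forall nz (fun i => filter_forall nz (PF i)); exact.
by apply: filterS => y Py; apply: PS.
Qed.

Lemma open_zariski_neq0 (L : numFieldType) k l (P : mpoly.mpoly (k * l) L) :
  open ([set z | poly_eval P z != 0] : set (zariski L k l)).
Proof.
exists [set [set z | poly_eval P z != 0]]; last by rewrite bigcup_set1.
move=> _ ->.
by apply: (finI_from1 (fun U : set (zariski L k l) => U)); exists P.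
Qed.

(** Composing a polynomial with a polynomial map gives a polynomial, so preimages of principal open
    sets are principal; finite intersections and unions follow. *)
Lemma zariski_continuous (L : numFieldType) k l
    (F : 'M[L]_(p, q) -> 'M[L]_(k, l)) :
  (forall i j, polyfun (fun z => F z i j)) ->
  continuous (F : zariski L p q -> zariski L k l).
Proof.
move=> polyF; apply/continuousP => _ [D' sD' <-].
rewrite preimage_bigcup; apply: bigcup_open => V /sD'[E sE <-].
rewrite preimage_bigcap openE => z zE.
apply: (filter_bigI (F := nbhs z)) => U UE.
have /set_mem[P PE] := sE _ UE.
have polyPF : polyfun (fun y => poly_eval P (F y)).
  apply: polyfun_meval => k0; case/mxvec_indexP: k0 => i j.
  by under eq_fun do rewrite mxvecE.
have [Q QE] := polyfun_poly_eval polyPF.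
apply: open_nbhs_nbhs; split; last exact: zE.
rewrite (_ : _ @^-1` _ = [set y | poly_eval Q y != 0]).
  exact: open_zariski_neq0.
by rewrite PE /preimage /= -QE.
Qed.

Lemma gopen_preimage k l (F : 'M[K]_(p, q) -> 'M[K]_(k, l))
    (O : set 'M[K]_(k, l)) :
  (forall i j, polyfun (fun z => F z i j)) -> gopen O -> gopen (F @^-1` O).
Proof.
rewrite /gopen => polyF; case: ifP => _ oO.
  by move/continuousP : (zariski_continuous polyF); exact.
by move/continuousP : (polyfun_continuous_mx polyF); exact.
Qed.

Lemma gopen_neq0 (f : 'M[K]_(p, q) -> K) :
  polyfun f -> gopen [set z | f z != 0].
Proof.
move=> polyf; rewrite /gopen; case: ifP => _.
  have [P ->] := polyfun_poly_eval polyf; exact: open_zariski_neq0.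
rewrite (_ : [set z | _] = f @^-1` (~` [set 0])); last first.
  by apply/seteqP; split=> z /= /eqP.
apply: open_comp; last first.
  apply: closed_openC; apply: accessible_closed_set1.
  exact/hausdorff_accessible/norm_hausdorff.
move=> z _; have := @polyfun_differentiable _ _ _ _ z polyf.
move=> /(@differentiable_continuous _ _ K^o); exact.
Qed.

End Regular.

(** * The annihilator on Grassmann bundles *)

(** The [k] upper rows leave room for the coordinates of the base point in a frame. *)
Lemma polyfun_completion (K : numFieldType) k d d' N (dN : (d + d')%N = N)
    (D : 'M[K]_(d', N)) i j :
  polyfun (fun B : 'M[K]_(k + d, N) => completion dN D (dsubmx B) i j).
Proof.
under eq_fun do rewrite castmxE mxE.
case: (fintype.split _) => l; last exact: polyfun_cst.
by under eq_fun do rewrite mxE; exact: polyfun_coord.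
Qed.

Lemma polyfun_ann_frame (K : numFieldType) k d d' N (dN : (d + d')%N = N)
    (D : 'M[K]_(d', N)) i j :
  polyfun (fun B : 'M[K]_(k + d, N) => ann_frame dN D (dsubmx B) i j).
Proof.
have cE (B : 'M[K]_(k + d, N)) : ann_frame dN D (dsubmx B) i j =
    (\adj (completion dN D (dsubmx B))) (cast_ord (esym (erefl N)) j)
       (cast_ord (esym (esym dN)) (rshift d i)).
  by rewrite [LHS]mxE [LHS]mxE castmxE.
under eq_fun do rewrite cE.
apply: polyfun_adj => {cE}i {}j; exact: polyfun_completion.
Qed.

Section AnnihilatorPlanes.
Context (R : realType) (g : geometry) (n : nat) (M : manifold R g n).
Let K := scalars R g.
Let N := amb M.

Lemma exists_chart (x : M) : exists i : chart_index M, dom i x.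
Proof.
case: M x => X I A D C ? _ _ _ _ cover /= x.
by case: ifP cover => _ [] => [J _ /(_ x)[i _]|_ [J _ /(_ x)[i _]]]; exists i.
Qed.

Lemma dim_plane d P (p : planes (M := M) d P) i :
  dom i (foot p) -> \dim (plane p i) = d.
Proof. by case: p => x V dV ? ? /= /dV. Qed.

Lemma planeP d P (p : planes (M := M) d P) : P (foot p) (plane p).
Proof. by case: p. Qed.

(** Outside the chart domains both families vanish by convention, so agreement on the domains
    suffices. *)
Lemma planes_eq d P (p q : planes (M := M) d P) : foot p = foot q ->
  (forall i, dom i (foot p) -> plane p i = plane q i) -> p = q.
Proof.
case: p q => x V dV V0 PV [y W dW W0 PW] /= xy.
rewrite -{y}xy in dW W0 PW * => VW.
have {}VW : V = W.
  apply/funext => i; have [ix|ix] := pselect (dom i x); first exact: VW.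
  by rewrite V0 ?W0.
rewrite -{W}VW in dW W0 PW *.
by congr Planes; exact: Prop_irrelevance.
Qed.

Lemma frameE d P i (p : planes (M := M) d P) B : frame i p B <->
  [/\ dom i (foot p), usubmx B = chart i (foot p) &
      limg (mxfun (dsubmx B)) = plane p i].
Proof. by []. Qed.

(** * Fibrewise annihilator maps, treated for both directions at once *)

Context (d d' : nat) (P P' : M -> (chart_index M -> {vspace 'rV[K]_N}) -> Prop).
Context (xi : planes d P -> planes d' P').
Hypothesis foot_xi : forall p, foot (xi p) = foot p.
Hypothesis plane_xi :
  forall p i, dom i (foot p) -> plane (xi p) i = annv (plane p i).

Let frame_xi (dN : (d + d')%N = N) (D : 'M[K]_(d', N)) i p B :
  frame i p B -> \det (completion dN D (dsubmx B)) != 0 ->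
  frame i (xi p) (col_mx (usubmx B) (ann_frame dN D (dsubmx B))).
Proof.
move=> /frameE[ip Bx Bp] detB; apply/frameE.
by rewrite foot_xi col_mxKu col_mxKd plane_xi // limg_ann_frame // Bp.
Qed.

Let frame_completion i (p : planes d P) B (dN : (d + d')%N = N) : frame i p B ->
  exists D, \det (completion dN D (dsubmx B)) != 0.
Proof.
move=> /frameE[ip _ Bp]; apply: completion_exists.
by apply/eqP; rewrite -dim_limg_mx Bp (dim_plane ip).
Qed.

(** A framed plane has dimension d <= N, and its annihilator has dimension both d' and N - d. The
    equation is thus drawn from the existence of a frame. *)
Let frame_dim i (p : planes d P) B : frame i p B -> (d + d')%N = N.
Proof.
move=> /frameE[ip _ _]; have ixp : dom i (foot (xi p)) by rewrite foot_xi.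
rewrite -(dim_plane ixp) plane_xi // dim_annv dim_plane // subnKC //.
by rewrite -(dim_plane ip) dimv_le_rV.
Qed.

Let gopen_completion (dN : (d + d')%N = N) (D : 'M[K]_(d', N)) :
  gopen [set B : 'M[K]_(1 + d, N) | \det (completion dN D (dsubmx B)) != 0].
Proof.
apply: (@gopen_neq0 R g); apply: polyfun_det => i j; exact: polyfun_completion.
Qed.

Lemma ann_continuous : continuous xi.
Proof.
apply/continuousP => S oS.
suff : final_open (@frame _ _ _ M d P) (xi @^-1` S) by [].
move=> i; have [W gW WS] := oS i.
have [dN|dN] := pselect ((d + d')%N = N); last first.
  (* Without d + d' = N there are no frames in this chart, and the condition is void. *)
  by exists setT => [|p B /frame_dim]; [exact: gopenT|].
pose G D (B : 'M[K]_(1 + d, N)) :=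
  col_mx (usubmx B) (ann_frame dN D (dsubmx B)).
pose U D := [set B : 'M[K]_(1 + d, N) | \det (completion dN D (dsubmx B)) != 0].
(* The union runs over all completions D. Which D is used does not matter, since every frame of
   [xi p] decides membership of [xi p] in [S]. *)
exists (\bigcup_D (U D `&` G D @^-1` W)).
  apply: gopen_bigcup => D _; apply: gopenI; first exact: gopen_completion.
  apply: gopen_preimage gW => k l; under eq_fun do rewrite mxE.
  case: (fintype.split _) => m; last exact: polyfun_ann_frame.
  by under eq_fun do rewrite mxE; exact: polyfun_coord.
move=> p B pB; split=> [[D _ [UB WB]]|Sp].
  by apply/(WS (xi p) (G D B)) => //; exact: frame_xi.
have [D UB] := frame_completion dN pB.
exists D => //; split=> //; apply/(WS (xi p) (G D B)) => //; exact: frame_xi.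
Qed.

Lemma ann_regular_over A : regular_over A xi.
Proof.
move=> i p B _ pB; have dN := frame_dim pB.
have [D UB] := frame_completion dN pB.
exists [set B | \det (completion dN D (dsubmx B)) != 0].
exists (fun B => ann_frame dN D (dsubmx B)).
split; [exact: gopen_completion|exact: UB| |].
  by move=> k l; apply: polyfun_regular; exact: polyfun_ann_frame.
by move=> q C _ qC UC; exact: frame_xi.
Qed.

End AnnihilatorPlanes.

Lemma continuous_image_closure (T U : topologicalType) (f : T -> U)
    (A : set T) (B : set U) :
  continuous f -> (forall x, A x -> B (f x)) ->
  forall x, closure A x -> closure B (f x).
Proof.
move=> cf AB x clAx V /cf/clAx[y [Ay Vy]].
by exists (f y); split; first exact: AB.
Qed.

(** * The mutually inverse annihilator maps between the two Grassmann bundles *)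

Section AnnihilatorMaps.
Context (R : realType) (g : geometry) (n : nat) (M : manifold R g n) (r : nat).
Let K := scalars R g.
Let N := amb M.

(** The value off the chart domains is the one prescribed by [planes]; [annv] alone would give the
    whole space there. *)
Definition ann_plane (x : M) (V : chart_index M -> {vspace 'rV[K]_N}) i :
    {vspace 'rV[K]_N} :=
  if `[< dom i x >] then annv (V i) else 0%VS.

Lemma ann_plane_dom x V i : dom i x -> ann_plane x V i = annv (V i).
Proof. by move=> ix; rewrite /ann_plane asboolT. Qed.

Lemma ann_plane_ndom x V i : ~ dom i x -> ann_plane x V i = 0%VS.
Proof. by move=> ix; rewrite /ann_plane asboolF. Qed.

Lemma transition_dom i j (x : M) F : transition i j x F -> dom i x /\ dom j x.
Proof.
by move=> [ix [U [_ Ux _ /(_ x ix Ux)[jx _]]]].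
Qed.

(** The differential of a function vanishing on the model is conormal, hence lies in W; a vector
    annihilating W is therefore tangent. Compatibility with charts is the adjunction (v J) l^T = v
    (l J^T)^T between push-forward and pull-back. *)
Lemma sub_TM_ann x W : sub_cotM x W -> sub_TM x (ann_plane x W).
Proof.
move=> [conW trW]; split=> [i ix v|i j F tr v].
  rewrite ann_plane_dom // => /memv_annv vW U f gU Ux rf f0.
  set J := jacobian f _; rewrite -[J]trmxK; apply: vW; apply: (conW i ix).
  by move=> w; rewrite trmxK; apply; eauto.
have [ix jx] := transition_dom tr.
rewrite !ann_plane_dom // => /memv_annv vW; apply/memv_annv => l lW.
by have := vW _ (trW _ _ _ tr l lW); rewrite trmx_mul trmxK mulmxA.
Qed.

Lemma sub_cotM_ann x V : sub_TM x V -> sub_cotM x (ann_plane x V).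
Proof.
move=> [tanV trV]; split=> [i ix l cl|i j F tr l].
  rewrite ann_plane_dom //; apply/memv_annv => v vV; apply/eqP.
  by rewrite mulmx_tr_eq0C; apply/eqP/cl/(tanV i ix).
have [ix jx] := transition_dom tr.
rewrite !ann_plane_dom // => /memv_annv lV; apply/memv_annv => v vV.
by have := lV _ (trV _ _ _ tr v vV); rewrite trmx_mul mulmxA.
Qed.

Lemma Grass_codim_le (q : Grass_codim M r) : (r <= N)%N.
Proof. by case: (planeP q). Qed.

Lemma Grass_le (p : Grass M r) : (r <= N)%N.
Proof.
have [i ip] := exists_chart (foot p).
by rewrite -(dim_plane ip) dimv_le_rV.
Qed.

Program Definition ann_codim (q : Grass_codim M r) : Grass M r :=
  @Planes _ _ _ M r (@sub_TM _ _ _ M)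
    (foot q) (ann_plane (foot q) (plane q)) _ _ _.
Next Obligation.
move=> q i iq.
(* N - (N - r) = r requires r <= N, which every point of [Grass_codim] carries. *)
by rewrite ann_plane_dom // dim_annv (dim_plane iq) subKn // (Grass_codim_le q).
Qed.
Next Obligation. move=> q i; exact: ann_plane_ndom. Qed.
Next Obligation. by move=> q; apply: sub_TM_ann; case: (planeP q). Qed.

Program Definition ann_dim (p : Grass M r) : Grass_codim M r :=
  @Planes _ _ _ M (N - r) _ (foot p) (ann_plane (foot p) (plane p)) _ _ _.
Next Obligation.
by move=> p i ip; rewrite ann_plane_dom // dim_annv (dim_plane ip).
Qed.
Next Obligation. move=> p i; exact: ann_plane_ndom. Qed.
Next Obligation.
by move=> p; split; [exact: Grass_le|apply: sub_cotM_ann; exact: planeP].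
Qed.

Lemma plane_ann_codim q i :
  dom i (foot q) -> plane (ann_codim q) i = annv (plane q i).
Proof. exact: ann_plane_dom. Qed.

Lemma plane_ann_dim p i :
  dom i (foot p) -> plane (ann_dim p) i = annv (plane p i).
Proof. exact: ann_plane_dom. Qed.

Lemma ann_codimK : cancel ann_codim ann_dim.
Proof.
move=> q; apply: planes_eq => // i iq.
by rewrite plane_ann_dim // plane_ann_codim // annvK.
Qed.

Lemma ann_dimK : cancel ann_dim ann_codim.
Proof.
move=> p; apply: planes_eq => // i ip.
by rewrite plane_ann_codim // plane_ann_dim // annvK.
Qed.

Lemma ann_codim_annihilates q : annihilates q (ann_codim q).
Proof. by split=> // i iq v; rewrite plane_ann_codim //; exact: memv_annv. Qed.

(** * Kernels and images of the bivector field *)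

Context (pi : bivector M).

Lemma annv_lker_sharp i x :
  dom i x -> annv (lker (sharp_lin pi i x)) = limg (sharp_lin pi i x).
Proof.
move=> ix; apply: annv_lker_skew; case: pi => A ? skewA ? ?.
by apply: skewA; exists x.
Qed.

Lemma ann_codim_ker_points q :
  ker_points pi r q -> im_points pi r (ann_codim q).
Proof.
move=> [regq kerq]; split=> // i iq.
by rewrite plane_ann_codim // kerq // annv_lker_sharp.
Qed.

Lemma ann_dim_im_points p : im_points pi r p -> ker_points pi r (ann_dim p).
Proof.
move=> [regp imp]; split=> // i ip.
by rewrite plane_ann_dim // imp // -annv_lker_sharp // annvK.
Qed.

End AnnihilatorMaps.

Theorem proposition3p8 (R : realType) (g : geometry) (n r : nat)
    (M : manifold R g n) (pi : bivector M) :
  foliated pi ->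
  (forall x, Mreg pi x -> rank_at pi x r) ->
  exists (f : Grass_codim M r -> Grass M r) (h : Grass M r -> Grass_codim M r),
    [/\ isomorphism_over (Nbl_ker pi r) (Nbl_im pi r) f h,
        forall p, ker_points pi r p -> im_points pi r (f p) &
        forall p, Nbl_ker pi r p -> annihilates p (f p)].
Proof.
(* The witnesses are defined and continuous on the whole Grassmann bundles; the required isomorphism
   is their restriction. *)
move=> _ _; exists (@ann_codim R g n M r), (@ann_dim R g n M r).
have cont_codim : continuous (@ann_codim R g n M r).
  by apply: ann_continuous => // q i; exact: plane_ann_codim.
have cont_dim : continuous (@ann_dim R g n M r).
  by apply: ann_continuous => // p i; exact: plane_ann_dim.
split; [split| |].
(* A continuous map that sends kernels to images over the regular part sends the closure of the
   former into that of the latter. *)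
- exact: continuous_image_closure (@ann_codim_ker_points _ _ _ _ _ pi).
- exact: continuous_image_closure (@ann_dim_im_points _ _ _ _ _ pi).
- by move=> q _; exact: ann_codimK.
- by move=> p _; exact: ann_dimK.
- by [].
- exact: continuous_subspaceT.
- exact: continuous_subspaceT.
- by apply: ann_regular_over => // q i; exact: plane_ann_codim.
- by apply: ann_regular_over => // p i; exact: plane_ann_dim.
- exact: ann_codim_ker_points.
- by move=> q _; exact: ann_codim_annihilates.
Qed.
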